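(* Let $a,k,\gamma,q_0,u_0>0$ be constants, let $\beta,\delta$ be real constants with $\beta\ge\delta$ and $\beta+\delta+1>0$, and put $\alpha=\beta-\delta$. Consider the common system $$\frac{\partial u}{\partial t}=a^2\frac{\partial^2u}{\partial x^2}\ (0<x<s(t),\ t>0),\quad u(s(t),t)=0,\quad -k\frac{\partial u}{\partial x}(s(t),t)=\gamma s^{\beta}(t)\dot s^{\delta}(t)\dot s(t)\ (t>0),\quad s(0)=0. \quad( * )$$ Let $(P_N)$ be the problem $( * )$ together with $k\frac{\partial u}{\partial x}(0,t)=-q_0t^{\frac{\alpha-1}{2}}$, $t>0$, and let $(P_D)$ be the problem $( * )$ together with $u(0,t)=u_0t^{\alpha/2}$, $t>0$. Let $\xi_N$ be the unique positive solution of $$\frac{q_0}{\gamma2^{\beta}a^{\beta+\delta+1}}\cdot\frac{1}{M(\frac{\alpha}{2}+\frac12,\frac12,z^2)}=z^{\beta+\delta+1},\quad z>0.$$ If the parameters are related by $$u_0=\frac{2aq_0}{k}\,\xi_N\,\frac{M(-\frac{\alpha}{2}+\frac12,\frac32,-\xi_N^2)}{M(-\frac{\alpha}{2},\frac12,-\xi_N^2)},$$ then $(P_N)$ and $(P_D)$ are equivalent, i.e. they have the same similarity type solution $(u,s)$; moreover $\xi_N$ coincides with the unique positive solution $\xi_D$ of $$\frac{ku_0}{\gamma2^{\beta+1}a^{\beta+\delta+2}}\cdot\frac{1}{zM(\frac{\alpha}{2}+1,\frac32,z^2)}=z^{\beta+\delta+1},\quad z>0.$$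
   Context: $M$ is Kummer's confluent hypergeometric function of the first kind, $M(p,q,z)=\sum_{n=0}^{\infty}\frac{(p)_n}{(q)_n}\frac{z^n}{n!}$, with $(p)_0=1$, $(p)_n=p(p+1)\cdots(p+n-1)$. The dot denotes $d/dt$; the unknowns are $u(x,t)$, $0\le x\le s(t)$, $t>0$, and $s(t)$. A solution $(u,s)$ is of similarity type if $u(x,t)=t^{\alpha/2}\varphi(\eta)$, $\eta=\frac{x}{2a\sqrt t}$, with $\varphi$ twice continuously differentiable on $[0,\xi]$, and $s(t)=2\xi a\sqrt t$ for a constant $\xi>0$. Under the stated hypotheses each of the two problems has a unique similarity type solution, of the form $$u=t^{\alpha/2}\left[C_1M\left(-\tfrac{\alpha}{2},\tfrac12,-\eta^2\right)+C_2\eta M\left(-\tfrac{\alpha}{2}+\tfrac12,\tfrac32,-\eta^2\right)\right],\qquad s(t)=2\xi a\sqrt t.$$ For $(P_N)$: $\xi=\xi_N$, $C_1=\frac{2aq_0\xi_N}{k}\frac{M(-\frac{\alpha}{2}+\frac12,\frac32,-\xi_N^2)}{M(-\frac{\alpha}{2},\frac12,-\xi_N^2)}$, $C_2=-\frac{2aq_0}{k}$. For $(P_D)$: $\xi=\xi_D$, $C_1=u_0$, $C_2=-\dfrac{u_0M(-\frac{\alpha}{2},\frac12,-\xi_D^2)}{\xi_DM(-\frac{\alpha}{2}+\frac12,\frac32,-\xi_D^2)}$. *)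

(* Defs.v *)
From Stdlib Require Import Reals Factorial.
From Coquelicot Require Import Coquelicot.
Open Scope R_scope.

(* (p)_n = p (p+1) ... (p+n-1) *)
Fixpoint pochhammer (p : R) (n : nat) : R :=
  match n with
  | O => 1
  | S m => pochhammer p m * (p + INR m)
  end.

(* Kummer's confluent hypergeometric function of the first kind. [PSeries] is
   total, but for q = 1/2, 3/2 (the only values used) the series converges for
   all z. *)
Definition kummerM (p q z : R) : R :=
  PSeries (fun n => pochhammer p n / pochhammer q n / INR (fact n)) z.

Definition itvcc (b c : R) : R -> Prop := fun x => b <= x <= c.

(* [D_in f f' D x] is differentiability relative to D, hence one-sided at the
   end points of a closed interval; f' is only looked at in x. *)
Definition C2_on (D : R -> Prop) (f : R -> R) : Prop :=
  exists f1 f2 : R -> R,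
    (forall x, D x -> D_in f f1 D x) /\
    (forall x, D x -> D_in f1 f2 D x) /\
    continuous_on D f2.

(* The unknown u is only meaningful for 0 <= x <= s t, 0 < t, and s for 0 <= t.
   They are total functions here, so every condition below only depends on their
   values there; in particular the x-derivatives at x = 0 and x = s t are
   one-sided. *)
Definition heat_equation (a : R) (u : R -> R -> R) (s : R -> R) : Prop :=
  exists ut ux uxx : R -> R -> R,
    forall x t, 0 < t -> 0 < x < s t ->
      is_derive (fun tau => u x tau) t (ut x t) /\
      is_derive (fun y => u y t) x (ux x t) /\
      is_derive (fun y => ux y t) x (uxx x t) /\
      ut x t = a ^ 2 * uxx x t.

Definition stefan_condition (k gamma beta delta : R)
    (u : R -> R -> R) (s : R -> R) : Prop :=
  forall t, 0 < t ->
    exists ux_s ds : R,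
      D_in (fun y => u y t) (fun _ => ux_s) (itvcc 0 (s t)) (s t) /\
      is_derive s t ds /\
      - k * ux_s = gamma * Rpower (s t) beta * Rpower ds delta * ds.

Definition common_system (a k gamma beta delta : R)
    (u : R -> R -> R) (s : R -> R) : Prop :=
  heat_equation a u s /\
  (forall t, 0 < t -> u (s t) t = 0) /\
  stefan_condition k gamma beta delta u s /\
  s 0 = 0.

Definition problemN (a k gamma beta delta alpha q0 : R)
    (u : R -> R -> R) (s : R -> R) : Prop :=
  common_system a k gamma beta delta u s /\
  forall t, 0 < t ->
    exists ux_0 : R,
      D_in (fun y => u y t) (fun _ => ux_0) (itvcc 0 (s t)) 0 /\
      k * ux_0 = - q0 * Rpower t ((alpha - 1) / 2).

Definition problemD (a k gamma beta delta alpha u0 : R)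
    (u : R -> R -> R) (s : R -> R) : Prop :=
  common_system a k gamma beta delta u s /\
  forall t, 0 < t -> u 0 t = u0 * Rpower t (alpha / 2).

Definition similarity_type (a alpha : R) (u : R -> R -> R) (s : R -> R) : Prop :=
  exists (phi : R -> R) (xi : R),
    0 < xi /\
    C2_on (itvcc 0 xi) phi /\
    (forall t, 0 < t -> s t = 2 * xi * a * sqrt t) /\
    (forall x t, 0 < t -> 0 <= x <= s t ->
       u x t = Rpower t (alpha / 2) * phi (x / (2 * a * sqrt t))).

Definition same_solution (u : R -> R -> R) (s : R -> R)
    (v : R -> R -> R) (r : R -> R) : Prop :=
  (forall t, 0 <= t -> s t = r t) /\
  (forall x t, 0 < t -> 0 <= x <= s t -> u x t = v x t).

(* (u, s) is the similarity type solution of the problem P. *)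
Definition the_similarity_solution (a alpha : R)
    (P : (R -> R -> R) -> (R -> R) -> Prop)
    (u : R -> R -> R) (s : R -> R) : Prop :=
  P u s /\ similarity_type a alpha u s /\
  forall v r, P v r -> similarity_type a alpha v r -> same_solution u s v r.

(* Main.v *)
Require Import Defs.
From Stdlib Require Import Reals Factorial Lra.
From Coquelicot Require Import Coquelicot.
Open Scope R_scope.

(** With u = t^(alpha/2) f(x / (2 a sqrt t)) the heat equation becomes
    f'' + 2 x f' = 2 alpha f. The functions E = M(-alpha/2, 1/2, -x^2) and
    O = x M(-alpha/2 + 1/2, 3/2, -x^2) solve it with Wronskian e^(-x^2), so every
    solution on an open interval is f = c1 E + c2 O. The same uniqueness gives
    Kummer's transformation E = e^(-x^2) EE with EE = M(alpha/2 + 1/2, 1/2, x^2) and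
    O = e^(-x^2) OO with OO = x M(alpha/2 + 1, 3/2, x^2).
    At a zero xi of f the Wronskian yields f'(xi) EE(xi) = c2 and
    f'(xi) OO(xi) = - c1, so the Stefan condition turns into the equation for xi_N
    when c2 is prescribed (flux datum) and into the one for xi_D when c1 is
    prescribed (temperature datum). As alpha >= 0, EE and OO are positive and
    nondecreasing, whence each equation has at most one root. The relation between
    u0 and q0 says exactly that the solution with c2 = -2 a q0 / k has c1 = u0. *)

(** * Kummer's function *)

Definition kummer_coef (p q : R) (n : nat) : R :=
  pochhammer p n / pochhammer q n / INR (fact n).

Definition dkummerM (p q : R) : R -> R := PSeries (PS_derive (kummer_coef p q)).

Definition ddkummerM (p q : R) : R -> R :=
  PSeries (PS_derive (PS_derive (kummer_coef p q))).

Lemma pochhammer_pos (p : R) (n : nat) : 0 < p -> 0 < pochhammer p n.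
Proof.
intros hp; induction n as [|n IH]; simpl; [lra|].
apply Rmult_lt_0_compat; [exact IH|]. assert (H := pos_INR n); lra.
Qed.

(** Factor by factor, [Rabs (p + n) <= (Rabs p / q + 1) * (q + n)]; hence the quotient of the two
    Pochhammer symbols grows at most geometrically and the factorial wins. *)
Lemma pochhammer_ratio_le (p q : R) (n : nat) :
  0 < q -> Rabs (pochhammer p n) <= (Rabs p / q + 1) ^ n * pochhammer q n.
Proof.
intros hq; induction n as [|n IH]; simpl.
- rewrite Rabs_R1; lra.
- assert (Hn := pos_INR n). assert (Hp := Rabs_pos p).
  assert (Hq := pochhammer_pos q n hq).
  assert (Hc : 0 <= Rabs p / q) by (apply Rdiv_le_0_compat; assumption).
  rewrite Rabs_mult.
  apply Rle_trans with
    (((Rabs p / q + 1) ^ n * pochhammer q n) * ((Rabs p / q + 1) * (q + INR n))).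
  2: right; ring.
  apply Rmult_le_compat; try apply Rabs_pos; [exact IH|].
  apply Rle_trans with (Rabs p + INR n).
  + eapply Rle_trans; [apply Rabs_triang|]. rewrite (Rabs_pos_eq (INR n)); lra.
  + replace ((Rabs p / q + 1) * (q + INR n))
      with (Rabs p + INR n + (q + Rabs p / q * INR n)) by (field; lra).
    assert (0 <= Rabs p / q * INR n) by (apply Rmult_le_pos; assumption). lra.
Qed.

Lemma exp_term_le (x : R) (n : nat) : 0 <= x -> x ^ n / INR (fact n) <= exp x.
Proof.
intros hx. eapply Rle_trans; [|exact (exp_ge_taylor x n hx)].
assert (Hpos : forall m, 0 <= x ^ m / INR (fact m)).
{ intros m; apply Rdiv_le_0_compat; [apply pow_le, hx|apply INR_fact_lt_0]. }
destruct n as [|n]; [apply Rle_refl|rewrite tech5].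
assert (H := cond_pos_sum _ n Hpos). lra.
Qed.

(** The n-th term at radius [r] is at most [c ^ n / n!] with [c = (Rabs p / q + 1) * r], hence at
    most [exp c]. Bounded terms at every radius make the series entire. *)
Lemma kummer_coef_radius (p q : R) :
  0 < q -> CV_radius (kummer_coef p q) = p_infty.
Proof.
intros hq.
destruct (CV_radius_bounded (kummer_coef p q)) as [Hub _].
assert (H : forall r : R, 0 <= r -> Rbar_le r (CV_radius (kummer_coef p q))).
{ intros r hr; apply Hub. exists (exp ((Rabs p / q + 1) * r)); intros n.
  assert (Hc : 0 <= Rabs p / q) by (apply Rdiv_le_0_compat; [apply Rabs_pos|exact hq]).
  eapply Rle_trans; [|apply (exp_term_le _ n); apply Rmult_le_pos; lra].
  assert (Hq := pochhammer_pos q n hq). assert (Hf := INR_fact_lt_0 n).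
  assert (Hrn := pow_le r n hr).
  unfold kummer_coef, Rdiv.
  rewrite !Rabs_mult, (Rabs_pos_eq (/ pochhammer q n)), (Rabs_pos_eq (/ INR (fact n))),
    (Rabs_pos_eq (r ^ n)), Rpow_mult_distr;
    try (left; apply Rinv_0_lt_compat; assumption); try assumption.
  replace (((Rabs p * / q + 1) ^ n * r ^ n) * / INR (fact n)) with
    (((Rabs p / q + 1) ^ n * pochhammer q n) * / pochhammer q n * / INR (fact n) * r ^ n).
  2: unfold Rdiv; field; lra.
  repeat (apply Rmult_le_compat_r;
    [first [assumption | left; apply Rinv_0_lt_compat; assumption]|]).
  apply pochhammer_ratio_le, hq. }
(* A finite radius [r] is refuted by the bound at [Rabs r + 1], the value minus infinity by the
   bound at 0. *)
destruct (CV_radius (kummer_coef p q)) as [r| |] eqn:E; [|reflexivity|].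
- specialize (H (Rabs r + 1)). simpl in H. assert (H1 := Rabs_pos r).
  assert (H2 := Rle_abs r). lra.
- specialize (H 0 (Rle_refl 0)). contradiction.
Qed.

Section Kummer.

Context (p q : R) (hq : 0 < q).

(** This recurrence is Kummer's differential equation read off coefficientwise. *)
Lemma kummer_coef_succ (n : nat) :
  (q + INR n) * (INR (S n) * kummer_coef p q (S n)) = (p + INR n) * kummer_coef p q n.
Proof.
unfold kummer_coef. simpl pochhammer. rewrite fact_simpl, mult_INR.
assert (H1 := pochhammer_pos q n hq). assert (H2 := INR_fact_lt_0 n).
assert (H3 := pos_INR n). rewrite S_INR. field. lra.
Qed.

Lemma is_derive_kummerM (z : R) : is_derive (kummerM p q) z (dkummerM p q z).
Proof.
apply is_derive_PSeries.
change (Rbar_lt (Rabs z) (CV_radius (kummer_coef p q))).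
rewrite kummer_coef_radius by exact hq. exact I.
Qed.

Lemma is_derive_dkummerM (z : R) : is_derive (dkummerM p q) z (ddkummerM p q z).
Proof.
apply is_derive_PSeries.
rewrite CV_radius_derive, kummer_coef_radius by exact hq. exact I.
Qed.

Lemma kummer_equation (z : R) :
  z * ddkummerM p q z + (q - z) * dkummerM p q z - p * kummerM p q z = 0.
Proof.
pose (a := kummer_coef p q).
assert (H0 : ex_pseries a z).
{ apply CV_radius_inside. unfold a; rewrite kummer_coef_radius by exact hq; exact I. }
assert (H1 : ex_pseries (PS_derive a) z).
{ apply CV_radius_inside. unfold a.
  rewrite CV_radius_derive, kummer_coef_radius by exact hq; exact I. }
assert (H2 : ex_pseries (PS_derive (PS_derive a)) z).
{ apply CV_radius_inside. unfold a.
  rewrite !CV_radius_derive, kummer_coef_radius by exact hq; exact I. }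
change (z * PSeries (PS_derive (PS_derive a)) z
  + (q - z) * PSeries (PS_derive a) z - p * PSeries a z = 0).
(* [L] and [Rt] are the coefficients of [z M'' + q M'] and of [z M' + p M]. They agree by the
   recurrence; index 0 is separate because multiplication by [z] puts a zero there. *)
pose (L n := PS_incr_1 (PS_derive (PS_derive a)) n + q * PS_derive a n).
pose (Rt n := PS_incr_1 (PS_derive a) n + p * a n).
assert (EL : PSeries L z = z * PSeries (PS_derive (PS_derive a)) z + q * PSeries (PS_derive a) z).
{ rewrite <- PSeries_incr_1, <- PSeries_scal, <- PSeries_plus; [reflexivity| |].
  - apply ex_pseries_incr_1; exact H2.
  - apply ex_pseries_scal; [apply Rmult_comm|exact H1]. }
assert (ER : PSeries Rt z = z * PSeries (PS_derive a) z + p * PSeries a z).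
{ rewrite <- PSeries_incr_1, <- PSeries_scal, <- PSeries_plus; [reflexivity| |].
  - apply ex_pseries_incr_1; exact H1.
  - apply ex_pseries_scal; [apply Rmult_comm|exact H0]. }
assert (E : PSeries L z = PSeries Rt z).
{ apply PSeries_ext; intros n; unfold L, Rt, PS_derive.
  assert (Hs := kummer_coef_succ n). fold a in Hs.
  destruct n as [|n]; unfold PS_incr_1; simpl zero;
    [change (@zero R_NormedModule) with 0; simpl in *; lra|].
  rewrite (S_INR n) in *. lra. }
lra.
Qed.

Lemma kummerM_0 : kummerM p q 0 = 1.
Proof. unfold kummerM; rewrite PSeries_0; simpl; field. Qed.

Lemma kummerM_le (x y : R) : 0 < p -> 0 <= x <= y -> kummerM p q x <= kummerM p q y.
Proof.
intros hp hxy. apply Series_le.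
- intros n.
  assert (H : 0 <= kummer_coef p q n).
  { unfold kummer_coef. left. apply Rdiv_lt_0_compat; [apply Rdiv_lt_0_compat|];
      try (apply pochhammer_pos; assumption). apply INR_fact_lt_0. }
  split.
  + apply Rmult_le_pos; [exact H|apply pow_le; lra].
  + apply Rmult_le_compat_l; [exact H|apply pow_incr; exact hxy].
- apply ex_pseries_R. apply CV_radius_inside.
  change (Rbar_lt (Rabs y) (CV_radius (kummer_coef p q))).
  rewrite kummer_coef_radius by exact hq; exact I.
Qed.

Lemma kummerM_ge_1 (x : R) : 0 < p -> 0 <= x -> 1 <= kummerM p q x.
Proof. intros hp hx. rewrite <- kummerM_0. apply kummerM_le; [exact hp|lra]. Qed.

End Kummer.

(** * The similarity equation [f'' + 2 x f' = 2 alpha f] *)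

(** The second order equation is kept as a first order system, with [f1] carrying the derivative;
    the interval is open, so derivatives are two-sided. *)
Definition similarity_ode (alpha lo hi : R) (f f1 : R -> R) : Prop :=
  forall x, lo < x < hi ->
    is_derive f x (f1 x) /\ is_derive f1 x (2 * alpha * f x - 2 * x * f1 x).

Lemma is_derive_eq (f : R -> R) (x l l' : R) : is_derive f x l -> l = l' -> is_derive f x l'.
Proof. intros H <-; exact H. Qed.

Lemma Derive_value (f : R -> R) (x l : R) :
  is_derive f x l -> Derive (fun y : R => f y) x = l.
Proof. apply is_derive_unique. Qed.

Lemma is_derive_zero_constant (f : R -> R) (lo hi x y : R) :
  (forall z, lo < z < hi -> is_derive f z 0) ->
  lo < x < hi -> lo < y < hi -> f x = f y.
Proof.
intros Hf Hx Hy. destruct (Rtotal_order x y) as [H|[->|H]]; [|reflexivity|].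
- apply eq_is_derive; [intros t Ht; apply Hf; lra|exact H].
- symmetry; apply eq_is_derive; [intros t Ht; apply Hf; lra|exact H].
Qed.

(** Abel's identity: the Wronskian satisfies [W' = - 2 x W], so [W * exp (x ^ 2)] has derivative
    0. *)
Lemma wronskian (alpha lo hi : R) (f f1 g g1 : R -> R) (x y : R) :
  similarity_ode alpha lo hi f f1 -> similarity_ode alpha lo hi g g1 ->
  lo < x < hi -> lo < y < hi ->
  (f x * g1 x - f1 x * g x) * exp (x ^ 2) = (f y * g1 y - f1 y * g y) * exp (y ^ 2).
Proof.
intros Hf Hg.
apply (is_derive_zero_constant (fun z => (f z * g1 z - f1 z * g z) * exp (z ^ 2))).
intros z Hz. destruct (Hf z Hz) as [Df Df1]. destruct (Hg z Hz) as [Dg Dg1].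
auto_derive.
- repeat split; eexists; eassumption.
- rewrite (Derive_value _ _ _ Df), (Derive_value _ _ _ Dg),
    (Derive_value _ _ _ Df1), (Derive_value _ _ _ Dg1).
  ring.
Qed.

(** * The even and the odd Kummer solution *)

Definition evenK (alpha x : R) : R := kummerM (- (alpha / 2)) (1 / 2) (- x ^ 2).
Definition evenK1 (alpha x : R) : R :=
  - (2 * x) * dkummerM (- (alpha / 2)) (1 / 2) (- x ^ 2).
Definition oddK (alpha x : R) : R :=
  x * kummerM (- (alpha / 2) + 1 / 2) (3 / 2) (- x ^ 2).
Definition oddK1 (alpha x : R) : R :=
  kummerM (- (alpha / 2) + 1 / 2) (3 / 2) (- x ^ 2)
  - 2 * x ^ 2 * dkummerM (- (alpha / 2) + 1 / 2) (3 / 2) (- x ^ 2).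

(* Without this, unification of [kummerM] with [dkummerM] unfolds both series and diverges. *)
Local Opaque kummerM dkummerM ddkummerM.

(** Closes the differentiability goals left by [auto_derive] and replaces the formal derivatives of
    [kummerM] and [dkummerM] by their values. *)
Ltac kummer_derive :=
  auto_derive;
  [ repeat split;
    match goal with
    | |- ex_derive (fun x => kummerM ?p ?q x) ?z =>
        exact (ex_intro _ _ (is_derive_kummerM p q ltac:(lra) z))
    | |- ex_derive (fun x => dkummerM ?p ?q x) ?z =>
        exact (ex_intro _ _ (is_derive_dkummerM p q ltac:(lra) z))
    end
  | repeat match goal with
    | |- context [Derive (fun x => kummerM ?p ?q x) ?z] =>
        rewrite (Derive_value (kummerM p q) z _ (is_derive_kummerM p q ltac:(lra) z))
    | |- context [Derive (fun x => dkummerM ?p ?q x) ?z] =>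
        rewrite (Derive_value (dkummerM p q) z _ (is_derive_dkummerM p q ltac:(lra) z))
    end ].

Lemma evenK_ode (alpha lo hi : R) : similarity_ode alpha lo hi (evenK alpha) (evenK1 alpha).
Proof.
intros x _; unfold evenK, evenK1; split.
- kummer_derive. ring_simplify. replace (x * (x * 1)) with (x ^ 2) by ring. ring.
- assert (H := kummer_equation (- (alpha / 2)) (1 / 2) ltac:(lra) (- x ^ 2)).
  kummer_derive. replace (x * (x * 1)) with (x ^ 2) by ring. lra.
Qed.

Lemma oddK_ode (alpha lo hi : R) : similarity_ode alpha lo hi (oddK alpha) (oddK1 alpha).
Proof.
intros x _; unfold oddK, oddK1; split.
- kummer_derive. replace (x * (x * 1)) with (x ^ 2) by ring. ring.
- assert (H := kummer_equation (- (alpha / 2) + 1 / 2) (3 / 2) ltac:(lra) (- x ^ 2)).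
  kummer_derive. replace (x * (x * 1)) with (x ^ 2) by ring.
  (* The residual of the similarity equation is [-4 x] times Kummer's equation at [- x ^ 2]. *)
  apply Rminus_diag_uniq. apply (f_equal (Rmult (-4 * x))) in H. rewrite Rmult_0_r in H.
  rewrite <- H. field.
Qed.

Lemma evenK_0 (alpha : R) : evenK alpha 0 = 1.
Proof. unfold evenK. replace (- 0 ^ 2) with 0 by ring. apply kummerM_0. Qed.

Lemma evenK1_0 (alpha : R) : evenK1 alpha 0 = 0.
Proof. unfold evenK1. ring. Qed.

Lemma oddK_0 (alpha : R) : oddK alpha 0 = 0.
Proof. unfold oddK. ring. Qed.

Lemma oddK1_0 (alpha : R) : oddK1 alpha 0 = 1.
Proof.
unfold oddK1. replace (- 0 ^ 2) with 0 by ring. rewrite kummerM_0. ring.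
Qed.

(** At 0 the Wronskian is [1 * 1 - 0 * 0 = 1], and Abel's identity transports this value to [x]. *)
Lemma wronskian_even_odd (alpha x : R) :
  evenK alpha x * oddK1 alpha x - evenK1 alpha x * oddK alpha x = exp (- x ^ 2).
Proof.
assert (H : (evenK alpha x * oddK1 alpha x - evenK1 alpha x * oddK alpha x) * exp (x ^ 2) = 1).
{ assert (Hx := Rle_abs x). assert (Hx' := Rle_abs (- x)). rewrite Rabs_Ropp in Hx'.
  rewrite (wronskian alpha (- Rabs x - 1) (Rabs x + 1) _ _ _ _ x 0
    (evenK_ode _ _ _) (oddK_ode _ _ _)) by lra.
  rewrite evenK_0, evenK1_0, oddK_0, oddK1_0.
  replace (0 ^ 2) with 0 by ring. rewrite exp_0; ring. }
rewrite exp_Ropp. apply (Rmult_eq_reg_r (exp (x ^ 2))).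
2: apply Rgt_not_eq, exp_pos.
rewrite H, Rinv_l; [reflexivity|apply Rgt_not_eq, exp_pos].
Qed.

(** Cramer's rule: up to sign the coefficients are the Wronskians of [f] with the odd and the even
    solution, times [exp (x ^ 2)]. These are constant, so their values at the midpoint serve
    everywhere. *)
Lemma similarity_ode_general (alpha lo hi : R) (f f1 : R -> R) :
  lo < hi -> similarity_ode alpha lo hi f f1 ->
  exists c1 c2, forall x, lo < x < hi ->
    f x = c1 * evenK alpha x + c2 * oddK alpha x /\
    f1 x = c1 * evenK1 alpha x + c2 * oddK1 alpha x.
Proof.
intros Hlh Hf. pose (m := (lo + hi) / 2).
exists ((f m * oddK1 alpha m - f1 m * oddK alpha m) * exp (m ^ 2)),
  (- ((f m * evenK1 alpha m - f1 m * evenK alpha m) * exp (m ^ 2))).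
intros x Hx.
assert (Ho := wronskian alpha lo hi f f1 _ _ x m Hf (oddK_ode alpha lo hi) Hx
  ltac:(unfold m; lra)).
assert (He := wronskian alpha lo hi f f1 _ _ x m Hf (evenK_ode alpha lo hi) Hx
  ltac:(unfold m; lra)).
rewrite <- Ho, <- He.
assert (W : (evenK alpha x * oddK1 alpha x - evenK1 alpha x * oddK alpha x) * exp (x ^ 2) = 1).
{ rewrite wronskian_even_odd, <- exp_plus, Rplus_opp_l. apply exp_0. }
split.
- transitivity (f x * ((evenK alpha x * oddK1 alpha x - evenK1 alpha x * oddK alpha x)
    * exp (x ^ 2))); [rewrite W|]; ring.
- transitivity (f1 x * ((evenK alpha x * oddK1 alpha x - evenK1 alpha x * oddK alpha x)
    * exp (x ^ 2))); [rewrite W|]; ring.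
Qed.

Lemma similarity_ode_initial (alpha : R) (f f1 : R -> R) :
  (forall lo hi, similarity_ode alpha lo hi f f1) ->
  forall x, f x = f 0 * evenK alpha x + f1 0 * oddK alpha x.
Proof.
intros Hf x.
assert (Hx := Rle_abs x). assert (Hx' := Rle_abs (- x)). rewrite Rabs_Ropp in Hx'.
destruct (similarity_ode_general alpha (- Rabs x - 1) (Rabs x + 1) f f1 ltac:(lra) (Hf _ _))
  as (c1 & c2 & H).
destruct (H 0 ltac:(lra)) as [H0 H01]. rewrite evenK_0, oddK_0 in H0.
rewrite evenK1_0, oddK1_0 in H01.
rewrite H0, H01, (proj1 (H x ltac:(lra))). ring.
Qed.

(** The right side solves the same equation with value 1 and slope 0 at the origin. Its Kummer
    parameters are positive for [alpha >= 0], so positivity becomes visible, which it is not with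
    [- (alpha / 2)]. *)
Lemma evenK_transform (alpha x : R) :
  evenK alpha x = exp (- x ^ 2) * kummerM (alpha / 2 + 1 / 2) (1 / 2) (x ^ 2).
Proof.
pose (M := kummerM (alpha / 2 + 1 / 2) (1 / 2)).
pose (M1 := dkummerM (alpha / 2 + 1 / 2) (1 / 2)).
pose (f x := exp (- x ^ 2) * M (x ^ 2)).
pose (f1 x := exp (- x ^ 2) * (2 * x * M1 (x ^ 2) - 2 * x * M (x ^ 2))).
assert (Hf : forall lo hi, similarity_ode alpha lo hi f f1).
{ intros lo hi z _. unfold f, f1, M, M1. split.
  - kummer_derive. replace (z * (z * 1)) with (z ^ 2) by ring. ring.
  - assert (H := kummer_equation (alpha / 2 + 1 / 2) (1 / 2) ltac:(lra) (z ^ 2)).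
    kummer_derive. replace (z * (z * 1)) with (z ^ 2) by ring.
    (* Here the residual is [4 exp (- z ^ 2)] times Kummer's equation at [z ^ 2]. *)
    apply Rminus_diag_uniq. apply (f_equal (Rmult (4 * exp (- z ^ 2)))) in H.
    rewrite Rmult_0_r in H. rewrite <- H. field. }
fold (M (x ^ 2)). change (evenK alpha x = f x).
rewrite (similarity_ode_initial alpha f f1 Hf). unfold f, f1, M.
replace (- 0 ^ 2) with 0 by ring. replace (0 ^ 2) with 0 by ring.
rewrite kummerM_0, exp_0. ring.
Qed.

(** As for the even solution, now with value 0 and slope 1 at the origin. *)
Lemma oddK_transform (alpha x : R) :
  oddK alpha x = exp (- x ^ 2) * (x * kummerM (alpha / 2 + 1) (3 / 2) (x ^ 2)).
Proof.
pose (M := kummerM (alpha / 2 + 1) (3 / 2)).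
pose (M1 := dkummerM (alpha / 2 + 1) (3 / 2)).
pose (f x := exp (- x ^ 2) * (x * M (x ^ 2))).
pose (f1 x := exp (- x ^ 2) *
  (M (x ^ 2) + 2 * x ^ 2 * M1 (x ^ 2) - 2 * x ^ 2 * M (x ^ 2))).
assert (Hf : forall lo hi, similarity_ode alpha lo hi f f1).
{ intros lo hi z _. unfold f, f1, M, M1. split.
  - kummer_derive. replace (z * (z * 1)) with (z ^ 2) by ring. ring.
  - assert (H := kummer_equation (alpha / 2 + 1) (3 / 2) ltac:(lra) (z ^ 2)).
    kummer_derive. replace (z * (z * 1)) with (z ^ 2) by ring.
    apply Rminus_diag_uniq. apply (f_equal (Rmult (4 * z * exp (- z ^ 2)))) in H.
    rewrite Rmult_0_r in H. rewrite <- H. field. }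
change (oddK alpha x = f x).
rewrite (similarity_ode_initial alpha f f1 Hf). unfold f, f1, M.
replace (- 0 ^ 2) with 0 by ring. replace (0 ^ 2) with 0 by ring.
rewrite kummerM_0, exp_0. ring.
Qed.

(** * One-sided derivatives and self-similar functions *)

(** End points included, [x] is a limit of interior points other than itself; this is what makes
    one-sided limits unique. *)
Lemma interval_adherent (lo hi x : R) :
  lo < hi -> lo <= x <= hi -> adhDa (D_x (fun y => lo < y < hi) x) x.
Proof.
intros Hlh Hx eps Heps. destruct (Rle_lt_dec x ((lo + hi) / 2)) as [H|H].
(* The step goes towards the farther end: [eps / 2] keeps it close, a quarter of the length keeps it
   strictly inside. *)
- assert (Hm : 0 < Rmin (eps / 2) ((hi - lo) / 4)) by (apply Rmin_pos; lra).
  assert (H1 := Rmin_l (eps / 2) ((hi - lo) / 4)).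
  assert (H2 := Rmin_r (eps / 2) ((hi - lo) / 4)).
  exists (x + Rmin (eps / 2) ((hi - lo) / 4)). repeat split; try lra.
  unfold Rdist. rewrite Rabs_pos_eq; lra.
- assert (Hm : 0 < Rmin (eps / 2) ((hi - lo) / 4)) by (apply Rmin_pos; lra).
  assert (H1 := Rmin_l (eps / 2) ((hi - lo) / 4)).
  assert (H2 := Rmin_r (eps / 2) ((hi - lo) / 4)).
  exists (x - Rmin (eps / 2) ((hi - lo) / 4)). repeat split; try lra.
  unfold Rdist. rewrite Rabs_left; lra.
Qed.

Lemma is_derive_D_in (D : R -> Prop) (f g d : R -> R) (x : R) :
  is_derive g x (d x) -> D x -> (forall y, D y -> f y = g y) -> D_in f d D x.
Proof.
intros Hg Dx Hfg.
assert (H : D_in g d D x).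
{ apply (D_in_imp g d no_cond); [intros y _; exact I|].
  apply derivable_pt_lim_D_in, is_derive_Reals, Hg. }
unfold D_in in *. eapply limit1_ext; [|exact H].
intros y [Hy _]. simpl. rewrite (Hfg y Hy), (Hfg x Dx). reflexivity.
Qed.

(** Both derivatives are limits of difference quotients along interior points, and such a limit is
    unique. So one-sided derivatives can be computed from an extension [g] across the end point. *)
Lemma D_in_value (f g d : R -> R) (lo hi x l : R) :
  lo < hi -> itvcc lo hi x -> D_in f d (itvcc lo hi) x ->
  (forall y, itvcc lo hi y -> f y = g y) -> is_derive g x l -> d x = l.
Proof.
intros Hlh Hx Hd Hfg Hg.
assert (Hl := is_derive_D_in (itvcc lo hi) f g (fun _ => l) x Hg Hx Hfg).
assert (Hsub : forall y, D_x (fun y => lo < y < hi) x y -> D_x (itvcc lo hi) x y)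
  by (unfold D_x, itvcc; intros y [H1 H2]; split; [lra|exact H2]).
eapply single_limit; [exact (interval_adherent lo hi x Hlh Hx)| |];
  [exact (limit1_imp _ _ _ _ _ Hsub Hd)|exact (limit1_imp _ _ _ _ _ Hsub Hl)].
Qed.

(** Carries an identity from the open interval to its end points; the derivative of [g] supplies its
    continuity. *)
Lemma continue_in_closure (f g : R -> R) (lo hi x l : R) :
  lo < hi -> itvcc lo hi x -> continue_in f (itvcc lo hi) x ->
  (forall y, lo < y < hi -> f y = g y) -> is_derive g x l -> f x = g x.
Proof.
intros Hlh Hx Hf Hfg Hg.
assert (Hc : continue_in g no_cond x).
{ apply (cont_deriv g (fun _ => l)). apply derivable_pt_lim_D_in, is_derive_Reals, Hg. }
eapply single_limit; [exact (interval_adherent lo hi x Hlh Hx)| |].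
- eapply limit1_imp; [|exact Hf]. unfold D_x, itvcc; intros y [H1 H2]; split; [lra|exact H2].
- eapply limit1_ext; [intros y [Hy _]; symmetry; exact (Hfg y Hy)|].
  eapply limit1_imp; [|exact Hc]. intros y [_ H2]; split; [exact I|exact H2].
Qed.

Lemma Rpower_1_base (y : R) : Rpower 1 y = 1.
Proof. unfold Rpower. rewrite ln_1, Rmult_0_r. apply exp_0. Qed.

Lemma is_derive_Rpower (t b : R) :
  0 < t -> is_derive (fun x => Rpower x b) t (b * Rpower t b / t).
Proof.
intros ht. apply is_derive_Reals.
replace (b * Rpower t b / t) with (b * Rpower t (b - 1)).
- apply derivable_pt_lim_power, ht.
- unfold Rminus. rewrite Rpower_plus, Rpower_Ropp, Rpower_1 by exact ht. field. lra.
Qed.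

Lemma ln_sqrt (t : R) : 0 < t -> ln (sqrt t) = ln t / 2.
Proof.
intros ht. rewrite <- (Rpower_sqrt t ht). unfold Rpower. rewrite ln_exp. field.
Qed.

Lemma Rpower_over_sqrt (t alpha : R) :
  0 < t -> Rpower t (alpha / 2) / sqrt t = Rpower t ((alpha - 1) / 2).
Proof.
intros ht. rewrite <- (Rpower_sqrt t ht). unfold Rdiv at 1.
rewrite <- Rpower_Ropp, <- Rpower_plus. f_equal. field.
Qed.

(** For [s = 2 xi a sqrt t] the speed is [xi a / sqrt t]. The resulting power of [t] has exponent
    [(alpha - 1) / 2], exactly that of the flux of a similarity solution. *)
Lemma stefan_powers (a xi t beta delta : R) :
  0 < a -> 0 < xi -> 0 < t ->
  Rpower (2 * xi * a * sqrt t) beta * Rpower (xi * a / sqrt t) delta * (xi * a / sqrt t)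
  = Rpower 2 beta * Rpower a (beta + delta + 1) * Rpower xi (beta + delta + 1)
    * Rpower t ((beta - delta - 1) / 2).
Proof.
intros ha hxi ht. assert (hs := sqrt_lt_R0 t ht).
assert (hd : 0 < xi * a / sqrt t)
  by (apply Rdiv_lt_0_compat; [apply Rmult_lt_0_compat|]; assumption).
(* Once the bare speed factor is an exponential too, both sides are single exponentials and only the
   exponents remain to be compared. *)
rewrite <- (exp_ln (xi * a / sqrt t) hd) at 2.
unfold Rpower. rewrite <- !exp_plus. f_equal.
unfold Rdiv at 1 2.
rewrite !ln_mult, ln_Rinv, ln_sqrt
  by (repeat apply Rmult_lt_0_compat; try apply Rinv_0_lt_compat; lra).
field.
Qed.

(** * Profiles, self-similar functions and their derivatives *)

Definition profile (alpha c1 c2 x : R) : R := c1 * evenK alpha x + c2 * oddK alpha x.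
Definition profile1 (alpha c1 c2 x : R) : R := c1 * evenK1 alpha x + c2 * oddK1 alpha x.

Lemma profile_ode (alpha c1 c2 lo hi : R) :
  similarity_ode alpha lo hi (profile alpha c1 c2) (profile1 alpha c1 c2).
Proof.
intros x Hx. destruct (evenK_ode alpha lo hi x Hx) as [He He1].
destruct (oddK_ode alpha lo hi x Hx) as [Ho Ho1]. unfold profile, profile1. split.
- apply (is_derive_plus (fun x => c1 * evenK alpha x) (fun x => c2 * oddK alpha x));
    apply is_derive_scal; assumption.
- eapply is_derive_eq.
  + apply (is_derive_plus (fun x => c1 * evenK1 alpha x) (fun x => c2 * oddK1 alpha x));
      apply is_derive_scal; eassumption.
  + unfold plus; simpl; ring.
Qed.

Lemma is_derive_profile (alpha c1 c2 x : R) :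
  is_derive (profile alpha c1 c2) x (profile1 alpha c1 c2 x).
Proof. apply (profile_ode alpha c1 c2 (x - 1) (x + 1) x); lra. Qed.

Lemma is_derive_profile1 (alpha c1 c2 x : R) :
  is_derive (profile1 alpha c1 c2) x
    (2 * alpha * profile alpha c1 c2 x - 2 * x * profile1 alpha c1 c2 x).
Proof. apply (profile_ode alpha c1 c2 (x - 1) (x + 1) x); lra. Qed.

Lemma profile_0 (alpha c1 c2 : R) : profile alpha c1 c2 0 = c1.
Proof. unfold profile. rewrite evenK_0, oddK_0. ring. Qed.

Lemma profile1_0 (alpha c1 c2 : R) : profile1 alpha c1 c2 0 = c2.
Proof. unfold profile1. rewrite evenK1_0, oddK1_0. ring. Qed.

Definition self_similar (a alpha : R) (f : R -> R) (x t : R) : R :=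
  Rpower t (alpha / 2) * f (x / (2 * a * sqrt t)).

Definition front (a xi t : R) : R := 2 * xi * a * sqrt t.

Lemma front_pos (a xi t : R) : 0 < a -> 0 < xi -> 0 < t -> 0 < front a xi t.
Proof.
intros ha hxi ht. assert (hs := sqrt_lt_R0 t ht).
unfold front. repeat apply Rmult_lt_0_compat; lra.
Qed.

Lemma front_eta (a xi t : R) :
  0 < a -> 0 < t -> front a xi t / (2 * a * sqrt t) = xi.
Proof. intros ha ht. assert (hs := sqrt_lt_R0 t ht). unfold front. field. lra. Qed.

Lemma is_derive_front (a xi t : R) :
  0 < t -> is_derive (front a xi) t (xi * a / sqrt t).
Proof.
intros ht. assert (hs := sqrt_lt_R0 t ht). unfold front.
auto_derive; [exact ht|field; lra].
Qed.

Lemma is_derive_self_similar_x (a alpha : R) (f : R -> R) (x t l : R) :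
  0 < a -> 0 < t -> is_derive f (x / (2 * a * sqrt t)) l ->
  is_derive (fun y => self_similar a alpha f y t) x
    (Rpower t (alpha / 2) / sqrt t * l / (2 * a)).
Proof.
intros ha ht Hf. assert (hs := sqrt_lt_R0 t ht). unfold self_similar.
auto_derive; [eexists; exact Hf|].
change (x * / (2 * a * sqrt t)) with (x / (2 * a * sqrt t)).
rewrite (Derive_value _ _ _ Hf). field. lra.
Qed.

Lemma is_derive_self_similar_t (a alpha : R) (f : R -> R) (x t l : R) :
  0 < a -> 0 < t -> is_derive f (x / (2 * a * sqrt t)) l ->
  is_derive (self_similar a alpha f x) t
    (Rpower t (alpha / 2) / t * (alpha / 2 * f (x / (2 * a * sqrt t))
       - x / (2 * a * sqrt t) / 2 * l)).
Proof.
intros ha ht Hf. assert (hs := sqrt_lt_R0 t ht).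
assert (Hp := is_derive_Rpower t (alpha / 2) ht). unfold self_similar.
assert (H2 : t = sqrt t * sqrt t) by (symmetry; apply sqrt_sqrt; lra).
auto_derive.
- repeat split; try (eexists; eassumption); [exact ht|].
  apply Rgt_not_eq; repeat apply Rmult_lt_0_compat; lra.
- change (x * / (2 * a * sqrt t)) with (x / (2 * a * sqrt t)).
  rewrite (Derive_value _ _ _ Hf), (Derive_value (fun t => Rpower t (alpha / 2)) _ _ Hp).
  (* With [t] replaced by [r * r], where [r] is its square root, the identity becomes rational. *)
  generalize (f (x / (2 * a * sqrt t))) (Rpower t (alpha / 2)). intros y p.
  clear Hp Hf. revert H2 hs. generalize (sqrt t). intros r -> hr.
  field. lra.
Qed.

(** * Reduction of the free boundary problems *)

(** Everything happens at [t = 1]: there [u_t] equals [alpha / 2 * phi - y / 2 * phi'] by similarity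
    and [a ^ 2 * u_xx = phi'' / 4] by the heat equation. *)
Lemma similarity_profile_ode (a alpha xi : R) (u : R -> R -> R) (s phi : R -> R) :
  0 < a -> 0 < xi -> heat_equation a u s ->
  (forall t, 0 < t -> s t = front a xi t) ->
  (forall x t, 0 < t -> 0 <= x <= s t -> u x t = self_similar a alpha phi x t) ->
  exists phi1, similarity_ode alpha 0 xi phi phi1.
Proof.
intros ha hxi (ut & ux & uxx & Hheat) Hs Hu.
(* The chain rule applied to [phi y = u (2 * a * y) 1]. *)
exists (fun y => 2 * a * ux (2 * a * y) 1).
intros y Hy.
assert (Hdom : 0 < 2 * a * y < s 1).
{ rewrite Hs by lra. unfold front. rewrite sqrt_1. split.
  - repeat apply Rmult_lt_0_compat; lra.
  - replace (2 * xi * a * 1) with (2 * a * xi) by ring. apply Rmult_lt_compat_l; lra. }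
destruct (Hheat (2 * a * y) 1 ltac:(lra) Hdom) as (Ht & Hx & Hxx & Heq).
assert (Hphi : is_derive phi y (2 * a * ux (2 * a * y) 1)).
{ apply (is_derive_ext_loc (fun z => u (2 * a * z) 1)).
  - assert (Hm : 0 < Rmin y (xi - y)) by (apply Rmin_pos; lra).
    exists (mkposreal _ Hm). intros z Hz.
    change (Rabs (z - y) < Rmin y (xi - y)) in Hz. apply Rabs_def2 in Hz.
    assert (H1 := Rmin_l y (xi - y)). assert (H2 := Rmin_r y (xi - y)).
    rewrite Hu; [|lra|].
    + unfold self_similar. rewrite Rpower_1_base, sqrt_1, Rmult_1_l. f_equal. field. lra.
    + rewrite Hs by lra. unfold front. rewrite sqrt_1. split.
      * repeat apply Rmult_le_pos; lra.
      * replace (2 * xi * a * 1) with (2 * a * xi) by ring. apply Rmult_le_compat_l; lra.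
  - auto_derive; [eexists; exact Hx|].
    rewrite (Derive_value (fun z => u z 1) _ _ Hx). ring. }
split; [exact Hphi|].
assert (Ht' : is_derive (fun tau => u (2 * a * y) tau) 1
  (alpha / 2 * phi y - y / 2 * (2 * a * ux (2 * a * y) 1))).
{ apply (is_derive_ext_loc (self_similar a alpha phi (2 * a * y))).
  - assert (Hyx : 0 < y / xi < 1).
    { split; [apply Rdiv_lt_0_compat; lra|]. apply Rmult_lt_reg_r with xi; [lra|].
      unfold Rdiv. rewrite Rmult_assoc, Rinv_l; lra. }
    (* The point [2 * a * y] lies behind the front at time [z] as soon as [y / xi <= sqrt z], which
       dictates this radius around 1. *)
    assert (Hm : 0 < 1 - (y / xi) ^ 2) by nra.
    exists (mkposreal _ Hm). intros z Hz.
    change (Rabs (z - 1) < 1 - (y / xi) ^ 2) in Hz. apply Rabs_def2 in Hz.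
    assert (Hsq : y / xi <= sqrt z).
    { rewrite <- (sqrt_pow2 (y / xi)) by lra. apply sqrt_le_1_alt. lra. }
    assert (Hz0 : 0 < z) by nra.
    symmetry. apply Hu; [exact Hz0|]. rewrite Hs by exact Hz0. split; [lra|].
    unfold front. replace (2 * a * y) with (2 * xi * a * (y / xi)) by (field; lra).
    apply Rmult_le_compat_l; [|exact Hsq]. repeat apply Rmult_le_pos; lra.
  - assert (Heta : 2 * a * y / (2 * a * sqrt 1) = y) by (rewrite sqrt_1; field; lra).
    eapply is_derive_eq.
    + apply is_derive_self_similar_t; [exact ha|lra|rewrite Heta; exact Hphi].
    + rewrite Heta, Rpower_1_base. field. }
assert (E : ut (2 * a * y) 1 = alpha / 2 * phi y - y / 2 * (2 * a * ux (2 * a * y) 1)).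
{ rewrite <- (is_derive_unique _ _ _ Ht). exact (is_derive_unique _ _ _ Ht'). }
rewrite Heq in E.
auto_derive; [eexists; exact Hxx|].
rewrite (Derive_value (fun z => ux z 1) _ _ Hxx).
apply (f_equal (Rmult 4)) in E. lra.
Qed.

(** The two conditions at the front for a similarity profile, with the common factor
    [t ^ ((alpha - 1) / 2)] cancelled from the Stefan condition. *)
Definition free_boundary (a k gamma beta delta alpha c1 c2 xi : R) : Prop :=
  0 < xi /\ profile alpha c1 c2 xi = 0 /\
  - k * profile1 alpha c1 c2 xi / (2 * a)
  = gamma * Rpower 2 beta * Rpower a (beta + delta + 1) * Rpower xi (beta + delta + 1).

(** The equation determines [phi] inside [(0, xi)] up to two constants and continuity carries this
    to the end points; the conditions at the front, read at [t = 1], then give [free_boundary]. *)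
Lemma similarity_solution_form (a k gamma beta delta alpha : R)
    (u : R -> R -> R) (s : R -> R) :
  0 < a ->
  common_system a k gamma beta delta u s -> similarity_type a alpha u s ->
  exists c1 c2 xi, free_boundary a k gamma beta delta alpha c1 c2 xi /\
    same_solution u s (self_similar a alpha (profile alpha c1 c2)) (front a xi).
Proof.
intros ha (Hheat & Hzero & Hstefan & Hs0) (phi & xi & hxi & (p1 & p2 & Hp1 & _) & Hs & Hu).
destruct (similarity_profile_ode a alpha xi u s phi ha hxi Hheat Hs Hu) as [phi1 Hode].
destruct (similarity_ode_general alpha 0 xi phi phi1 hxi Hode) as (c1 & c2 & Hc).
assert (Hphi : forall y, 0 <= y <= xi -> phi y = profile alpha c1 c2 y).
{ intros y Hy. eapply (continue_in_closure phi _ 0 xi); [exact hxi|exact Hy| | |].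
  - exact (cont_deriv _ _ _ _ (Hp1 y Hy)).
  - intros z Hz. exact (proj1 (Hc z Hz)).
  - apply is_derive_profile. }
assert (Hsame : same_solution u s (self_similar a alpha (profile alpha c1 c2)) (front a xi)).
{ split.
  - intros t [ht|<-]; [exact (Hs t ht)|]. unfold front. rewrite Hs0, sqrt_0. ring.
  - intros x t ht Hx. rewrite (Hu x t ht Hx). unfold self_similar. f_equal. apply Hphi.
    assert (hq := sqrt_lt_R0 t ht). assert (Hd : 0 < 2 * a * sqrt t)
      by (repeat apply Rmult_lt_0_compat; lra).
    rewrite (Hs t ht) in Hx. split; [apply Rdiv_le_0_compat; lra|].
    apply Rmult_le_reg_r with (2 * a * sqrt t); [exact Hd|].
    unfold Rdiv. rewrite Rmult_assoc, Rinv_l by lra. lra. }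
exists c1, c2, xi. split; [|exact Hsame].
destruct Hsame as [HsF HuF].
assert (Hf1 : s 1 = front a xi 1) by (apply Hs; lra).
assert (Hfp : 0 < front a xi 1) by (apply front_pos; lra).
split; [exact hxi|split].
- assert (H := Hzero 1 ltac:(lra)).
  rewrite HuF in H by lra. unfold self_similar in H.
  rewrite Hf1, front_eta, Rpower_1_base in H by lra. lra.
- destruct (Hstefan 1 ltac:(lra)) as (uxs & ds & HD & Hds & Hst).
  assert (Eds : ds = xi * a / sqrt 1).
  { rewrite <- (is_derive_unique _ _ _ Hds). apply is_derive_unique.
    apply (is_derive_ext_loc (front a xi)); [|apply is_derive_front; lra].
    exists (mkposreal 1 Rlt_0_1). intros z Hz. change (Rabs (z - 1) < 1) in Hz.
    apply Rabs_def2 in Hz. symmetry. apply Hs. lra. }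
  (* The profile is smooth beyond the front, so its two-sided derivative yields the one-sided one of
     [u]. *)
  assert (Eux : uxs = profile1 alpha c1 c2 xi / (2 * a)).
  { rewrite Hf1 in HD.
    refine (D_in_value _ (fun y => self_similar a alpha (profile alpha c1 c2) y 1)
      (fun _ => uxs) 0 (front a xi 1) (front a xi 1) _ Hfp _ HD _ _).
    - split; lra.
    - intros y Hy. apply HuF; [lra|]. rewrite Hf1. exact Hy.
    - eapply is_derive_eq.
      + apply is_derive_self_similar_x; [exact ha|lra|].
        rewrite front_eta by lra. apply is_derive_profile.
      + rewrite Rpower_1_base, sqrt_1. field. lra. }
  rewrite Hf1, Eds, Eux in Hst. unfold front in Hst.
  assert (HP := stefan_powers a xi 1 beta delta ha hxi Rlt_0_1).
  rewrite Rpower_1_base, Rmult_1_r in HP.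
  rewrite !(Rmult_assoc gamma), HP in Hst.
  rewrite !(Rmult_assoc gamma), <- Hst. unfold Rdiv. ring.
Qed.

(** The converse reduction: [alpha = beta - delta] makes the powers of [t] in the Stefan condition
    match at every time. *)
Lemma free_boundary_solution (a k gamma beta delta alpha c1 c2 xi : R) :
  0 < a -> alpha = beta - delta ->
  free_boundary a k gamma beta delta alpha c1 c2 xi ->
  common_system a k gamma beta delta
    (self_similar a alpha (profile alpha c1 c2)) (front a xi) /\
  similarity_type a alpha (self_similar a alpha (profile alpha c1 c2)) (front a xi).
Proof.
intros ha halpha (hxi & Hzero & Hflux).
split; [split; [|split; [|split]]|].
- exists (fun x t => Rpower t (alpha / 2) / t *
    (alpha / 2 * profile alpha c1 c2 (x / (2 * a * sqrt t))
     - x / (2 * a * sqrt t) / 2 * profile1 alpha c1 c2 (x / (2 * a * sqrt t)))).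
  exists (fun x t => Rpower t (alpha / 2) / sqrt t
    * profile1 alpha c1 c2 (x / (2 * a * sqrt t)) / (2 * a)).
  (* In [u_xx] the second derivative of the profile is expressed through the similarity equation. *)
  exists (fun x t => Rpower t (alpha / 2) / t
    * (2 * alpha * profile alpha c1 c2 (x / (2 * a * sqrt t))
       - 2 * (x / (2 * a * sqrt t)) * profile1 alpha c1 c2 (x / (2 * a * sqrt t)))
    / (4 * a ^ 2)).
  intros x t ht _. assert (hs := sqrt_lt_R0 t ht). split; [|split; [|split]].
  + apply (is_derive_self_similar_t a alpha (profile alpha c1 c2) x t _ ha ht).
    apply is_derive_profile.
  + apply is_derive_self_similar_x; [exact ha|exact ht|apply is_derive_profile].
  + assert (H := is_derive_self_similar_x a alpha _ x t _ ha ht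
      (is_derive_profile1 alpha c1 c2 _)).
    (* [u_x] is again self-similar with profile [profile1], up to a factor constant in [x], so the
       same differentiation rule applies to it. *)
    assert (He : forall y, / (2 * a * sqrt t)
        * self_similar a alpha (profile1 alpha c1 c2) y t
      = Rpower t (alpha / 2) / sqrt t * profile1 alpha c1 c2 (y / (2 * a * sqrt t)) / (2 * a))
      by (intros y; unfold self_similar; field; lra).
    apply (is_derive_ext _ _ _ _ He).
    eapply is_derive_eq; [exact (is_derive_scal _ _ _ _ H)|].
    replace (Rpower t (alpha / 2) / t) with (Rpower t (alpha / 2) / (sqrt t * sqrt t))
      by (rewrite sqrt_sqrt by lra; reflexivity).
    field. lra.
  + field. lra.
- intros t ht. unfold self_similar. rewrite front_eta, Hzero by assumption. ring.
- intros t ht. assert (hs := sqrt_lt_R0 t ht).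
  exists (Rpower t (alpha / 2) / sqrt t * profile1 alpha c1 c2 xi / (2 * a)), (xi * a / sqrt t).
  split; [|split].
  + eapply is_derive_D_in; [|split; [left; apply front_pos; assumption|apply Rle_refl]
      |reflexivity].
    apply is_derive_self_similar_x; [exact ha|exact ht|].
    rewrite front_eta by assumption. apply is_derive_profile.
  + apply is_derive_front, ht.
  + rewrite !(Rmult_assoc gamma).
    unfold front. rewrite stefan_powers, Rpower_over_sqrt by assumption.
    rewrite <- halpha.
    transitivity (- k * profile1 alpha c1 c2 xi / (2 * a) * Rpower t ((alpha - 1) / 2));
      [field; lra|].
    rewrite Hflux. ring.
- unfold front. rewrite sqrt_0. ring.
- exists (profile alpha c1 c2), xi. split; [exact hxi|split; [|split]].
  + exists (profile1 alpha c1 c2),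
      (fun x => 2 * alpha * profile alpha c1 c2 x - 2 * x * profile1 alpha c1 c2 x).
    split; [|split].
    * intros x Hx. eapply is_derive_D_in; [apply is_derive_profile|exact Hx|reflexivity].
    * intros x Hx. eapply is_derive_D_in; [apply is_derive_profile1|exact Hx|reflexivity].
    * apply continuous_on_forall. intros x _.
      assert (H1 := is_derive_profile alpha c1 c2 x).
      assert (H2 := is_derive_profile1 alpha c1 c2 x).
      assert (H : ex_derive (fun x =>
        2 * alpha * profile alpha c1 c2 x - 2 * x * profile1 alpha c1 c2 x) x)
        by (auto_derive; repeat split; eexists; eassumption).
      exact (ex_derive_continuous _ _ H).
  + intros t _. reflexivity.
  + intros x t _ _. reflexivity.
Qed.

(** The slope of the profile at 0 is [c2], so the flux scales in [t] exactly like the datum and time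
    1 decides. *)
Lemma neumann_condition (a k alpha q0 c1 c2 xi : R) (u : R -> R -> R) (s : R -> R) :
  0 < a -> 0 < xi ->
  same_solution u s (self_similar a alpha (profile alpha c1 c2)) (front a xi) ->
  (forall t, 0 < t -> exists ux_0 : R,
      D_in (fun y => u y t) (fun _ => ux_0) (itvcc 0 (s t)) 0 /\
      k * ux_0 = - q0 * Rpower t ((alpha - 1) / 2)) <->
  k * c2 / (2 * a) = - q0.
Proof.
intros ha hxi [Hs Hu].
assert (Hd : forall t, 0 < t ->
  is_derive (fun y => self_similar a alpha (profile alpha c1 c2) y t) 0
    (Rpower t ((alpha - 1) / 2) * c2 / (2 * a))).
{ intros t ht. rewrite <- Rpower_over_sqrt by exact ht.
  apply is_derive_self_similar_x; [exact ha|exact ht|].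
  unfold Rdiv. rewrite Rmult_0_l. eapply is_derive_eq; [apply is_derive_profile|].
  apply profile1_0. }
assert (Hst : forall t, 0 < t -> 0 < s t).
{ intros t ht. rewrite Hs by lra. apply front_pos; assumption. }
split.
- intros H. destruct (H 1 ltac:(lra)) as (ux0 & HD & Hk).
  assert (E : ux0 = Rpower 1 ((alpha - 1) / 2) * c2 / (2 * a)).
  { refine (D_in_value _ _ (fun _ => ux0) 0 (s 1) 0 _ (Hst 1 Rlt_0_1) _ HD _ (Hd 1 Rlt_0_1)).
    - split; [lra|left; apply Hst; lra].
    - intros y Hy. apply Hu; [lra|exact Hy]. }
  rewrite Rpower_1_base in *. rewrite E in Hk.
  replace (k * c2 / (2 * a)) with (k * (1 * c2 / (2 * a))) by (field; lra). lra.
- intros H t ht. exists (Rpower t ((alpha - 1) / 2) * c2 / (2 * a)). split.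
  + eapply is_derive_D_in; [exact (Hd t ht)|split; [lra|left; apply Hst, ht]|].
    intros y Hy. apply Hu; [exact ht|exact Hy].
  + rewrite <- H. field. lra.
Qed.

Lemma dirichlet_condition (a alpha u0 c1 c2 xi : R) (u : R -> R -> R) (s : R -> R) :
  0 < a -> 0 < xi ->
  same_solution u s (self_similar a alpha (profile alpha c1 c2)) (front a xi) ->
  (forall t, 0 < t -> u 0 t = u0 * Rpower t (alpha / 2)) <-> c1 = u0.
Proof.
intros ha hxi [Hs Hu].
assert (H0 : forall t, 0 < t -> u 0 t = Rpower t (alpha / 2) * c1).
{ intros t ht. rewrite Hu; [|exact ht|].
  - unfold self_similar, Rdiv. rewrite Rmult_0_l, profile_0. reflexivity.
  - rewrite Hs by lra. split; [lra|left; apply front_pos; assumption]. }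
split.
- intros H. specialize (H 1 Rlt_0_1). rewrite H0, Rpower_1_base in H by lra. lra.
- intros <- t ht. rewrite H0 by exact ht. ring.
Qed.

(** * The equations for the front *)

(** Multiplied by [exp (- xi ^ 2)], the left side is [profile1] times [evenK]. As the profile
    vanishes at [xi], this is [c2] times the Wronskian, and the exponential cancels. *)
Lemma flux_even (alpha c1 c2 xi : R) :
  profile alpha c1 c2 xi = 0 ->
  profile1 alpha c1 c2 xi * kummerM (alpha / 2 + 1 / 2) (1 / 2) (xi ^ 2) = c2.
Proof.
unfold profile, profile1; intros H. assert (W := wronskian_even_odd alpha xi).
apply (Rmult_eq_reg_l (exp (- xi ^ 2))); [|apply Rgt_not_eq, exp_pos].
transitivity ((c1 * evenK1 alpha xi + c2 * oddK1 alpha xi) * evenK alpha xi).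
- rewrite (evenK_transform alpha xi) at 1. ring.
- rewrite <- W. replace (c1 * evenK1 alpha xi) with (evenK1 alpha xi * c1) by ring.
  transitivity (evenK1 alpha xi * (c1 * evenK alpha xi + c2 * oddK alpha xi)
    + c2 * (evenK alpha xi * oddK1 alpha xi - evenK1 alpha xi * oddK alpha xi)); [ring|].
  rewrite H. ring.
Qed.

Lemma flux_odd (alpha c1 c2 xi : R) :
  profile alpha c1 c2 xi = 0 ->
  profile1 alpha c1 c2 xi * (xi * kummerM (alpha / 2 + 1) (3 / 2) (xi ^ 2)) = - c1.
Proof.
unfold profile, profile1; intros H. assert (W := wronskian_even_odd alpha xi).
apply (Rmult_eq_reg_l (exp (- xi ^ 2))); [|apply Rgt_not_eq, exp_pos].
transitivity ((c1 * evenK1 alpha xi + c2 * oddK1 alpha xi) * oddK alpha xi).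
- rewrite (oddK_transform alpha xi) at 1. ring.
- rewrite <- W.
  transitivity (oddK1 alpha xi * (c1 * evenK alpha xi + c2 * oddK alpha xi)
    - c1 * (evenK alpha xi * oddK1 alpha xi - evenK1 alpha xi * oddK alpha xi)); [ring|].
  rewrite H. ring.
Qed.

Lemma kummerM_sq_ge_1 (p q z : R) : 0 < p -> 0 < q -> 1 <= kummerM p q (z ^ 2).
Proof. intros hp hq. apply kummerM_ge_1; [exact hq|exact hp|apply pow2_ge_0]. Qed.

Lemma kummerM_sq_le (p q x y : R) :
  0 < p -> 0 < q -> 0 < x <= y -> kummerM p q (x ^ 2) <= kummerM p q (y ^ 2).
Proof.
intros hp hq Hxy. apply kummerM_le; [exact hq|exact hp|].
split; [apply pow2_ge_0|apply pow_incr; lra].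
Qed.

(** The equation amounts to [K = z ^ p * g z], whose right side is strictly increasing. *)
Lemma power_root_unique (K p x y : R) (g : R -> R) :
  0 < p -> (forall z, 0 < z -> 0 < g z) ->
  (forall z w, 0 < z <= w -> g z <= g w) ->
  0 < x -> 0 < y ->
  K * (1 / g x) = Rpower x p -> K * (1 / g y) = Rpower y p -> x = y.
Proof.
intros hp Hpos Hmono.
assert (Hlt : forall x y, 0 < x < y ->
  K * (1 / g x) = Rpower x p -> K * (1 / g y) = Rpower y p -> False).
{ intros z w Hzw Ez Ew. assert (Hz := Hpos z ltac:(lra)). assert (Hw := Hpos w ltac:(lra)).
  assert (H1 := Rlt_Rpower_l z w p hp Hzw). assert (H2 := Hmono z w ltac:(lra)).
  assert (Kz : K = Rpower z p * g z) by (rewrite <- Ez; field; lra).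
  assert (Kw : K = Rpower w p * g w) by (rewrite <- Ew; field; lra).
  assert (H3 : 0 < Rpower z p) by apply exp_pos.
  assert (H4 : Rpower z p * g z < Rpower w p * g w); [|lra].
  apply Rlt_le_trans with (Rpower w p * g z).
  - apply Rmult_lt_compat_r; assumption.
  - apply Rmult_le_compat_l; lra. }
intros Hx Hy Ex Ey. destruct (Rtotal_order x y) as [H|[H|H]]; [|exact H|]; exfalso.
- apply (Hlt x y); [lra|assumption|assumption].
- apply (Hlt y x); [lra|assumption|assumption].
Qed.

Lemma power_root_exists (K p : R) (g : R -> R) :
  0 < K -> 0 < p -> continuity g -> (forall z, 1 <= g z) ->
  (forall z w, 0 < z <= w -> g z <= g w) ->
  exists x, 0 < x /\ K * (1 / g x) = Rpower x p.
Proof.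
intros hK hp Hg Hge Hmono.
(* On the logarithmic scale z = e^y the intermediate value theorem applies on all of R. *)
pose (h y := exp (p * y) * g (exp y)).
assert (Hh : continuity h).
{ unfold h. apply continuity_mult.
  - apply (continuity_comp (fun y => p * y) exp).
    + apply continuity_scal, derivable_continuous, derivable_id.
    + apply derivable_continuous, derivable_exp.
  - apply (continuity_comp exp g); [apply derivable_continuous, derivable_exp|exact Hg]. }
assert (Hg1 := Hge 1).
(* At [lo] one has [z <= 1] and [z ^ p <= K / g 1], so monotonicity gives [h lo <= K]; at [hi] one
   has [z ^ p = K] and [g >= 1]. *)
pose (lo := Rmin 0 (ln (K / g 1) / p)). pose (hi := ln K / p).
assert (Hlo : h lo <= K).
{ unfold h. assert (H0 : lo <= 0) by apply Rmin_l.
  assert (H1 : p * lo <= ln (K / g 1)).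
  { apply Rle_trans with (p * (ln (K / g 1) / p)); [|right; field; lra].
    apply Rmult_le_compat_l; [lra|apply Rmin_r]. }
  assert (H2 : exp (p * lo) <= K / g 1).
  { rewrite <- (exp_ln (K / g 1)) by (apply Rdiv_lt_0_compat; lra).
    destruct H1 as [H1| ->]; [left; apply exp_increasing, H1|apply Rle_refl]. }
  assert (H3 : exp lo <= 1).
  { rewrite <- exp_0. destruct H0 as [H0| ->]; [left; apply exp_increasing, H0|apply Rle_refl]. }
  assert (H4 := exp_pos lo). assert (H5 := Hmono (exp lo) 1 ltac:(lra)).
  assert (H6 := exp_pos (p * lo)). assert (H7 := Hge (exp lo)).
  apply Rle_trans with (K / g 1 * g 1); [|right; field; lra].
  apply Rmult_le_compat; lra. }
assert (Hhi : K <= h hi).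
{ unfold h, hi. replace (p * (ln K / p)) with (ln K) by (field; lra).
  rewrite exp_ln by exact hK. assert (H := Hge (exp (ln K / p))).
  rewrite <- (Rmult_1_r K) at 1. apply Rmult_le_compat_l; lra. }
destruct (IVT_gen h lo hi K Hh) as (y & _ & Hy).
{ rewrite Rmin_left, Rmax_right by lra. lra. }
exists (exp y). split; [apply exp_pos|].
unfold Rpower. rewrite ln_exp, <- Hy. unfold h. field.
assert (H := Hge (exp y)). lra.
Qed.

Section StefanProblems.

Context (a k gamma beta delta alpha : R).
Context (ha : 0 < a) (hgamma : 0 < gamma) (halpha0 : 0 <= alpha).

(** By Kummer's transformation, [kN] and [kD] are [exp (z ^ 2)] times [evenK] and [oddK]. *)
Let kN z := kummerM (alpha / 2 + 1 / 2) (1 / 2) (z ^ 2).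
Let kD z := z * kummerM (alpha / 2 + 1) (3 / 2) (z ^ 2).

Lemma even_factor_pos (z : R) : 0 < kN z.
Proof. assert (H := kummerM_sq_ge_1 (alpha / 2 + 1 / 2) (1 / 2) z). unfold kN. lra. Qed.

Lemma odd_factor_pos (z : R) : 0 < z -> 0 < kD z.
Proof.
intros hz. assert (H := kummerM_sq_ge_1 (alpha / 2 + 1) (3 / 2) z).
unfold kD. apply Rmult_lt_0_compat; lra.
Qed.

Lemma evenK_pos (z : R) : 0 < evenK alpha z.
Proof.
rewrite evenK_transform. apply Rmult_lt_0_compat; [apply exp_pos|apply even_factor_pos].
Qed.

Lemma oddK_pos (z : R) : 0 < z -> 0 < oddK alpha z.
Proof.
intros hz. rewrite oddK_transform.
apply Rmult_lt_0_compat; [apply exp_pos|apply odd_factor_pos, hz].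
Qed.

(** By [flux_even] the slope at the front is [c2 / kN xi], so the Stefan condition involves only the
    flux datum and [xi]. *)
Lemma neumann_front_equation (q0 c1 c2 xi : R) :
  k * c2 / (2 * a) = - q0 -> 0 < xi -> profile alpha c1 c2 xi = 0 ->
  (free_boundary a k gamma beta delta alpha c1 c2 xi <->
   q0 / (gamma * Rpower 2 beta * Rpower a (beta + delta + 1)) * (1 / kN xi)
   = Rpower xi (beta + delta + 1)).
Proof.
intros Hc2 hxi Hz. assert (Hf := flux_even alpha c1 c2 xi Hz). fold (kN xi) in Hf.
assert (HN := even_factor_pos xi).
assert (H2 : 0 < Rpower 2 beta) by apply exp_pos.
assert (Ha : 0 < Rpower a (beta + delta + 1)) by apply exp_pos.
assert (E : - k * profile1 alpha c1 c2 xi / (2 * a) = q0 / kN xi).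
{ replace q0 with (- (k * c2 / (2 * a))) by lra.
  revert Hf. generalize (profile1 alpha c1 c2 xi). intros P <-. field. lra. }
unfold free_boundary. rewrite E. split.
- intros (_ & _ & H).
  transitivity (q0 / kN xi / (gamma * Rpower 2 beta * Rpower a (beta + delta + 1)));
    [|rewrite H]; field; repeat split; lra.
- intros H. split; [exact hxi|split; [exact Hz|]].
  rewrite <- H. field; repeat split; lra.
Qed.

Lemma dirichlet_front_equation (u0 c2 xi : R) :
  0 < xi -> profile alpha u0 c2 xi = 0 ->
  (free_boundary a k gamma beta delta alpha u0 c2 xi <->
   k * u0 / (gamma * Rpower 2 (beta + 1) * Rpower a (beta + delta + 2)) * (1 / kD xi)
   = Rpower xi (beta + delta + 1)).
Proof.
intros hxi Hz. assert (Hf := flux_odd alpha u0 c2 xi Hz). fold (kD xi) in Hf.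
assert (HD := odd_factor_pos xi hxi).
(* The exponents [beta + 1] and [beta + delta + 2] absorb the factor [2 * a] from the flux;
   splitting them recovers it. *)
replace (beta + delta + 2) with (beta + delta + 1 + 1) by ring.
rewrite (Rpower_plus beta 1 2), (Rpower_plus _ 1 a), !Rpower_1 by lra.
assert (H2 : 0 < Rpower 2 beta) by apply exp_pos.
assert (Ha : 0 < Rpower a (beta + delta + 1)) by apply exp_pos.
assert (E : - k * profile1 alpha u0 c2 xi / (2 * a) = k * u0 / (2 * a) / kD xi).
{ revert Hf. generalize (profile1 alpha u0 c2 xi). intros P HP.
  replace u0 with (- (P * kD xi)) by lra. field. lra. }
unfold free_boundary. rewrite E. split.
- intros (_ & _ & H).
  transitivity (k * u0 / (2 * a) / kD xi
    / (gamma * Rpower 2 beta * Rpower a (beta + delta + 1)));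
    [|rewrite H]; field; repeat split; lra.
- intros H. split; [exact hxi|split; [exact Hz|]].
  rewrite <- H. field; repeat split; lra.
Qed.

End StefanProblems.

(** * Coincidence of the two similarity solutions *)

Theorem corollary3p1 (a k gamma q0 u0 beta delta alpha : R)
    (ha : 0 < a) (hk : 0 < k) (hgamma : 0 < gamma) (hq0 : 0 < q0) (hu0 : 0 < u0)
    (hbd : beta >= delta) (hbd1 : 0 < beta + delta + 1)
    (halpha : alpha = beta - delta) :
  exists xiN : R,
    unique (fun z => 0 < z /\
      q0 / (gamma * Rpower 2 beta * Rpower a (beta + delta + 1))
        * (1 / kummerM (alpha / 2 + 1 / 2) (1 / 2) (z ^ 2))
      = Rpower z (beta + delta + 1)) xiN /\
    (u0 = 2 * a * q0 / k * xiN *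
            (kummerM (- (alpha / 2) + 1 / 2) (3 / 2) (- xiN ^ 2) /
             kummerM (- (alpha / 2)) (1 / 2) (- xiN ^ 2)) ->
     (exists (u : R -> R -> R) (s : R -> R),
        the_similarity_solution a alpha
          (problemN a k gamma beta delta alpha q0) u s /\
        the_similarity_solution a alpha
          (problemD a k gamma beta delta alpha u0) u s) /\
     unique (fun z => 0 < z /\
       k * u0 / (gamma * Rpower 2 (beta + 1) * Rpower a (beta + delta + 2))
         * (1 / (z * kummerM (alpha / 2 + 1) (3 / 2) (z ^ 2)))
       = Rpower z (beta + delta + 1)) xiN).
Proof.
assert (ha0 : 0 <= alpha) by lra.
assert (H2 : 0 < Rpower 2 beta) by apply exp_pos.
assert (Ha : 0 < Rpower a (beta + delta + 1)) by apply exp_pos.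
assert (uniqueN : forall x y, 0 < x -> 0 < y ->
  q0 / (gamma * Rpower 2 beta * Rpower a (beta + delta + 1))
    * (1 / kummerM (alpha / 2 + 1 / 2) (1 / 2) (x ^ 2)) = Rpower x (beta + delta + 1) ->
  q0 / (gamma * Rpower 2 beta * Rpower a (beta + delta + 1))
    * (1 / kummerM (alpha / 2 + 1 / 2) (1 / 2) (y ^ 2)) = Rpower y (beta + delta + 1) ->
  x = y).
{ intros x y.
  apply (power_root_unique _ _ x y (fun z => kummerM (alpha / 2 + 1 / 2) (1 / 2) (z ^ 2)) hbd1).
  - intros z _. apply even_factor_pos, ha0.
  - intros z w Hzw. apply kummerM_sq_le; lra. }
assert (uniqueD : forall x y, 0 < x -> 0 < y ->
  k * u0 / (gamma * Rpower 2 (beta + 1) * Rpower a (beta + delta + 2))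
    * (1 / (x * kummerM (alpha / 2 + 1) (3 / 2) (x ^ 2))) = Rpower x (beta + delta + 1) ->
  k * u0 / (gamma * Rpower 2 (beta + 1) * Rpower a (beta + delta + 2))
    * (1 / (y * kummerM (alpha / 2 + 1) (3 / 2) (y ^ 2))) = Rpower y (beta + delta + 1) ->
  x = y).
{ intros x y.
  apply (power_root_unique _ _ x y (fun z => z * kummerM (alpha / 2 + 1) (3 / 2) (z ^ 2)) hbd1).
  - intros z hz. apply odd_factor_pos; assumption.
  - intros z w Hzw. assert (H1 := kummerM_sq_ge_1 (alpha / 2 + 1) (3 / 2) z).
    apply Rmult_le_compat; [lra|lra|lra|]. apply kummerM_sq_le; lra. }
destruct (power_root_exists (q0 / (gamma * Rpower 2 beta * Rpower a (beta + delta + 1)))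
  (beta + delta + 1) (fun z => kummerM (alpha / 2 + 1 / 2) (1 / 2) (z ^ 2)))
  as (xi & hxi & Exi).
- apply Rdiv_lt_0_compat; [exact hq0|]. repeat apply Rmult_lt_0_compat; assumption.
- exact hbd1.
- intros z. apply derivable_continuous_pt.
  assert (HK := is_derive_kummerM (alpha / 2 + 1 / 2) (1 / 2) ltac:(lra) (z ^ 2)).
  apply ex_derive_Reals_0. auto_derive.
  replace (z * (z * 1)) with (z ^ 2) by ring. eexists; exact HK.
- intros z. apply kummerM_sq_ge_1; lra.
- intros z w Hzw. apply kummerM_sq_le; lra.
- exists xi. split.
  { split; [split; assumption|]. intros y [hy Ey]. exact (uniqueN xi y hxi hy Exi Ey). }
  intros Hu0.
  assert (HE := evenK_pos alpha ha0 xi). assert (HO := oddK_pos alpha ha0 xi hxi).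
  (* The odd coefficient forced by the flux datum. *)
  pose (c2 := - (2 * a * q0 / k)).
  assert (Hc2 : k * c2 / (2 * a) = - q0) by (unfold c2; field; lra).
  assert (Hu0' : u0 = - c2 * (oddK alpha xi / evenK alpha xi)).
  { rewrite Hu0. unfold c2, oddK, evenK. unfold Rdiv. ring. }
  (* The relation between the data says that the profile with coefficients [u0] and [c2] vanishes at
     [xi]. *)
  assert (Hzero : profile alpha u0 c2 xi = 0) by (unfold profile; rewrite Hu0'; field; lra).
  assert (Hfb : free_boundary a k gamma beta delta alpha u0 c2 xi)
    by (apply (neumann_front_equation a k gamma beta delta alpha ha hgamma ha0 q0);
        assumption).
  (* The same free boundary read through [c1 = u0] makes [xi] a root of the temperature equation,
     which settles existence of that root. *)
  assert (ED := proj1 (dirichlet_front_equation a k gamma beta delta alpha ha hgamma ha0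
    u0 c2 xi hxi Hzero) Hfb).
  destruct (free_boundary_solution a k gamma beta delta alpha u0 c2 xi ha halpha Hfb)
    as [Hcs Hst].
  assert (Hrefl : same_solution (self_similar a alpha (profile alpha u0 c2)) (front a xi)
    (self_similar a alpha (profile alpha u0 c2)) (front a xi)) by (split; reflexivity).
  assert (Hsym : forall v r, same_solution v r
      (self_similar a alpha (profile alpha u0 c2)) (front a xi) ->
    same_solution (self_similar a alpha (profile alpha u0 c2)) (front a xi) v r).
  { intros v r [Hr Hv]. split; [intros t ht; symmetry; exact (Hr t ht)|].
    intros x t ht Hx. symmetry. apply Hv; [exact ht|]. rewrite Hr by lra. exact Hx. }
  split; [|split; [split; assumption|]; intros y [hy Ey]; exact (uniqueD xi y hxi hy ED Ey)].
  exists (self_similar a alpha (profile alpha u0 c2)), (front a xi). split.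
  + split; [split; [exact Hcs|]|split; [exact Hst|]].
    { exact (proj2 (neumann_condition a k alpha q0 u0 c2 xi _ _ ha hxi Hrefl) Hc2). }
    (* For a competitor the flux datum fixes [d2], the root equation fixes the front, and the zero
       at the front fixes [d1] because [evenK] is positive there. *)
    intros v r [Hvcs Hvq] Hvst. apply Hsym.
    destruct (similarity_solution_form a k gamma beta delta alpha v r ha Hvcs Hvst)
      as (d1 & d2 & eta & Hfb' & Hsame).
    assert (heta : 0 < eta) by apply Hfb'.
    assert (Hz' : profile alpha d1 d2 eta = 0) by apply Hfb'.
    assert (Hd2 := proj1 (neumann_condition a k alpha q0 d1 d2 eta v r ha heta Hsame) Hvq).
    assert (Eeta := proj1 (neumann_front_equation a k gamma beta delta alpha ha hgamma ha0
      q0 d1 d2 eta Hd2 heta Hz') Hfb').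
    assert (E := uniqueN eta xi heta hxi Eeta Exi). subst eta.
    assert (E2 : d2 = c2) by (unfold c2; replace q0 with (- (k * d2 / (2 * a))) by lra;
      field; lra).
    subst d2. unfold profile in Hz', Hzero.
    assert (E1 : d1 = u0) by (apply (Rmult_eq_reg_r (evenK alpha xi)); lra).
    subst d1. exact Hsame.
  + split; [split; [exact Hcs|]|split; [exact Hst|]].
    { exact (proj2 (dirichlet_condition a alpha u0 u0 c2 xi _ _ ha hxi Hrefl) eq_refl). }
    (* Dually, the temperature datum fixes [d1], then the front, and [d2] follows because [oddK] is
       positive at [xi]. *)
    intros v r [Hvcs Hvq] Hvst. apply Hsym.
    destruct (similarity_solution_form a k gamma beta delta alpha v r ha Hvcs Hvst)
      as (d1 & d2 & eta & Hfb' & Hsame).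
    assert (heta : 0 < eta) by apply Hfb'.
    assert (Hz' : profile alpha d1 d2 eta = 0) by apply Hfb'.
    assert (Hd1 := proj1 (dirichlet_condition a alpha u0 d1 d2 eta v r ha heta Hsame) Hvq).
    subst d1.
    assert (Eeta := proj1 (dirichlet_front_equation a k gamma beta delta alpha ha hgamma ha0
      u0 d2 eta heta Hz') Hfb').
    assert (E := uniqueD eta xi heta hxi Eeta ED). subst eta.
    unfold profile in Hz', Hzero.
    assert (E2 : d2 = c2) by (apply (Rmult_eq_reg_r (oddK alpha xi)); lra).
    subst d2. exact Hsame.
Qed.
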